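(* Let $m\ge 1$ and $0\le k<m$ be integers, let $K$ be a field in which $m\ne 0$, and let $\zeta_m$ be a primitive $m$-th root of unity in an extension field of $K$. Then for each rational function $\varphi(z)\in K(z)$ there is a unique rational function $\mathfrak{F}_{m,k}(\varphi)(z)\in K(z)$ characterized by the formula $$\mathfrak{F}_{m,k}(\varphi)(w^m)=\frac{1}{m w^k}\sum_{t=0}^{m-1}\zeta_m^{-kt}\,\varphi(\zeta_m^t w).$$
   Context: Here $w$ is an indeterminate, and the displayed formula is an identity in the rational function field $K(\zeta_m)(w)$. The function $\mathfrak{F}_{m,k}(\varphi)$ is called the $(m,k)$-Landen transform of $\varphi$. *)

(* Defs.v *)
From HB Require Import structures.
From mathcomp Require Import all_boot all_order all_algebra.
From mathcomp Require Import fraction generic_quotient.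

Set Implicit Arguments.
Unset Strict Implicit.
Unset Printing Implicit Defensive.

Import GRing.Theory.
Local Open Scope ring_scope.

Notation ratfun K := {fraction {poly K}}.
Notation "x %:F" := (@FracField.tofrac _ x) : ring_scope.

Definition ratfunC (L : fieldType) (c : L) : ratfun L := (c%:P)%:F.

Definition ratfunX (L : fieldType) : ratfun L := 'X%:F.

(* The value f(x) = p(x) / q(x) of f = p / q in K(z) at a point x of a field E,
   where j : K -> E is applied to the coefficients.  The representative p / q
   chosen by repr need not be reduced, so this is only meaningful when
   q(x) != 0; that is no restriction, and the choice of representative is
   irrelevant, when x is transcendental over K (ratfun_eval_div). *)
Definition ratfun_eval (K E : fieldType) (j : K -> E) (f : ratfun K) (x : E)
    : E :=
  (map_poly j \n_(repr f)).[x] / (map_poly j \d_(repr f)).[x].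

(* f(u) in L(w), for f in K(z), a field embedding iota : K -> L, and u in L(w);
   meaningful for nonconstant u such as w ^ m and c * w with c != 0
   (ratfun_subst_div). *)
Definition ratfun_subst (K L : fieldType) (iota : {rmorphism K -> L})
    (f : ratfun K) (u : ratfun L) : ratfun L :=
  ratfun_eval (fun c => ratfunC (iota c)) f u.

Lemma ratfun_eval_div (K E : fieldType) (j : {rmorphism K -> E}) (x : E)
    (p q : {poly K}) :
  (forall r : {poly K}, r != 0 -> (map_poly j r).[x] != 0) -> q != 0 ->
  ratfun_eval j (p%:F / q%:F) x = (map_poly j p).[x] / (map_poly j q).[x].
Proof.
move=> x_tr q0; rewrite /ratfun_eval; set f := _%:F / _%:F.
have d0 : \d_(repr f) != 0 by exact: denom_ratioP.
have fE : f = (\n_(repr f))%:F / (\d_(repr f))%:F.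
  apply: (canRL (mulfK _)); first by rewrite tofrac_eq0.
  rewrite -{1}[f]reprK; unlock FracField.tofrac; rewrite -[LHS]FracField.pi_mul.
  apply/eqmodP; rewrite /= FracField.equivfE /FracField.mulf.
  by rewrite !numden_Ratio ?mulf_neq0 ?oner_neq0 ?mulr1 // mulrC.
have /eqP := fE.
rewrite eqr_div ?tofrac_eq0 // -!tofracM tofrac_eq => /eqP pd.
apply/eqP; rewrite eqr_div ?x_tr //.
by rewrite -!hornerM -!rmorphM pd.
Qed.

Lemma ratfun_transcendental (K L : fieldType) (iota : {rmorphism K -> L})
    (u : {poly L}) (r : {poly K}) : (1 < size u)%N -> r != 0 ->
  (map_poly (fun c => ratfunC (iota c)) r).[u%:F] != 0.
Proof.
move=> u_gt1 r0.
have -> : map_poly (fun c => ratfunC (iota c)) r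
        = map_poly (@FracField.tofrac _) (map_poly polyC (map_poly iota r)).
  by rewrite -!map_poly_comp.
rewrite horner_map tofrac_eq0 -[X in X != 0]/(map_poly iota r \Po u).
by rewrite comp_poly_eq0 // map_poly_eq0.
Qed.

Lemma ratfun_subst_div (K L : fieldType) (iota : {rmorphism K -> L})
    (u : {poly L}) (p q : {poly K}) : (1 < size u)%N -> q != 0 ->
  ratfun_subst iota (p%:F / q%:F) u%:F =
  (map_poly iota p \Po u)%:F / (map_poly iota q \Po u)%:F.
Proof.
move=> u_gt1 q0; rewrite /ratfun_subst.
pose j : {rmorphism K -> ratfun L} := @FracField.tofrac _ \o polyC \o iota.
rewrite -[fun c => _]/(j : K -> _) ratfun_eval_div // => [|r r0].
  have jE r : (map_poly j r).[u%:F] = (map_poly iota r \Po u)%:F.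
    have -> : map_poly j r
        = map_poly (@FracField.tofrac _) (map_poly polyC (map_poly iota r)).
      by rewrite -!map_poly_comp.
    by rewrite horner_map.
  by rewrite !jE.
exact: ratfun_transcendental.
Qed.

(* Main.v *)
(* Some nonzero multiple of the denominator of phi is a polynomial in z^m, so
   phi = P(z) / Q(z^m) with P, Q over K.  Averaging P(zeta^t w) against
   zeta^(-kt) selects the monomials of P of degree congruent to k mod m, hence
   the transform is R(z) / Q(z), where the coefficient of z^j in R is that of
   z^(mj+k) in P.  Uniqueness holds because w^m is transcendental over K. *)
Require Import Defs.
From HB Require Import structures.
From mathcomp Require Import all_boot all_order all_algebra.
From mathcomp Require Import fraction generic_quotient.

Set Implicit Arguments.
Unset Strict Implicit.
Unset Printing Implicit Defensive.

Import GRing.Theory.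
Local Open Scope ring_scope.

Lemma fracE (R : idomainType) (f : {fraction R}) :
  exists p q : R, q != 0 /\ f = p%:F / q%:F.
Proof.
have d0 : \d_(repr f) != 0 by exact: denom_ratioP.
exists \n_(repr f), \d_(repr f); split=> //.
apply: (canRL (mulfK _)); first by rewrite tofrac_eq0.
(* Passing to representatives turns equality of fractions into cross-multiplication in [R]. *)
rewrite -{1}[f]reprK; unlock FracField.tofrac; rewrite -[LHS]FracField.pi_mul.
apply/eqmodP; rewrite /= FracField.equivfE /FracField.mulf.
by rewrite !numden_Ratio ?mulf_neq0 ?oner_neq0 ?mulr1 // mulrC.
Qed.

(* K[z] / (q) has dimension deg q, so the classes of u ^+ i for i <= deg q
   are linearly dependent. *)
Lemma dvdp_comp_poly_exists (K : fieldType) (q u : {poly K}) : q != 0 ->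
  exists2 Q : {poly K}, Q != 0 & q %| Q \Po u.
Proof.
move=> q0; pose n := (size q).-1.
have sq : size q = n.+1 by rewrite prednK // size_poly_gt0.
pose A := \matrix_(i < n.+1) (poly_rV (u ^+ i %% q) : 'rV[K]_n).
have [v v0 vA] : exists2 v : 'rV_n.+1, v != 0 & v *m A = 0.
  have : kermx A != 0.
    by rewrite kermx_eq0 -row_leq_rank -ltnNge ltnS rank_leq_col.
  by case/rowV0Pn=> v /sub_kermxP vA v0; exists v.
exists (rVpoly v); first by rewrite -(linear0 (@rVpoly K n.+1)) (can_eq rVpolyK).
have -> : rVpoly v \Po u = \sum_(i < n.+1) v 0 i *: u ^+ i.
  rewrite {1}[v]row_sum_delta linear_sum [LHS](linear_sum (comp_poly u)).
  by apply: eq_bigr => i _; rewrite linearZ /= comp_polyZ rVpoly_delta comp_Xn_poly.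
(* Remainders modulo [q] have size at most [n], so encoding them as row vectors of length [n] loses
   nothing. *)
rewrite /dvdp -(@poly_rV_K _ n (_ %% q)); last by rewrite -ltnS -[X in (_ < X)%N]sq ltn_modp.
rewrite (big_morph (fun p : {poly K} => p %% q) (modpD q) (mod0p q)).
apply/eqP; rewrite linear_sum /= -[RHS](linear0 (@rVpoly K n)) -[in RHS]vA mulmx_sum_row.
by congr rVpoly; apply: eq_bigr => i _; rewrite rowK modpZl linearZ.
Qed.

Lemma prim_root_neq0 (L : fieldType) (m : nat) (zeta : L) :
  m.-primitive_root zeta -> zeta != 0.
Proof.
move=> hz; have := oner_neq0 L; rewrite -(prim_expr_order hz) expf_eq0.
by rewrite (prim_order_gt0 hz).
Qed.

(** Orthogonality of characters: the sum is geometric with ratio [x = zeta ^+ i / zeta ^+ k], an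
    [m]-th root of unity, and [x = 1] exactly when [i] and [k] are congruent mod [m]. *)
Lemma sum_prim_root_expr (L : fieldType) (m k i : nat) (zeta : L) :
  m.-primitive_root zeta ->
  \sum_(t < m) zeta ^- (k * t) * zeta ^+ (t * i) =
  if i == k %[mod m] then m%:R else 0.
Proof.
move=> hz.
have z0 := prim_root_neq0 hz.
pose x := zeta ^+ i / zeta ^+ k.
have -> : \sum_(t < m) zeta ^- (k * t) * zeta ^+ (t * i) = \sum_(t < m) x ^+ t.
  by apply: eq_bigr => t _; rewrite expr_div_n -!exprM mulrC (mulnC i).
have xm : x ^+ m = 1.
  rewrite expr_div_n -!exprM !(mulnC _ m) !exprM (prim_expr_order hz).
  by rewrite !expr1n divr1.
rewrite -(eq_prim_root_expr hz); case: eqP => [ik|ik].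
  rewrite /x ik divff ?expf_neq0 //.
  by under eq_bigr do rewrite expr1n; rewrite sumr_const card_ord.
(* Since [x ^+ m = 1], the product of [x - 1] and the sum is zero. *)
have /eqP := subrX1 x m; rewrite xm subrr eq_sym mulf_eq0 subr_eq0.
by case/orP=> [/eqP/divr1_eq//|/eqP].
Qed.

(** For [0 < m] the bound [size p] truncates nothing: [size p <= j] implies
    [size p <= m * j + k]. *)
Definition poly_section (R : nzSemiRingType) (m k : nat) (p : {poly R}) :
    {poly R} :=
  \poly_(j < size p) p`_(m * j + k).

Lemma coef_poly_section (R : nzSemiRingType) (m k : nat) (p : {poly R}) j :
  (0 < m)%N -> (poly_section m k p)`_j = p`_(m * j + k).
Proof.
move=> m0; rewrite coef_poly; case: ltnP => // pj.
by rewrite nth_default // (leq_trans pj) // (leq_trans (leq_pmull j m0)) ?leq_addr.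
Qed.

Lemma map_poly_section (R S : nzRingType) (f : {rmorphism R -> S}) (m k : nat)
    (p : {poly R}) : (0 < m)%N ->
  map_poly f (poly_section m k p) = poly_section m k (map_poly f p).
Proof.
by move=> m0; apply/polyP=> j; rewrite coef_map !coef_poly_section // coef_map.
Qed.

Lemma coef_comp_polyZX (R : comNzRingType) (p : {poly R}) (c : R) i :
  (p \Po (c *: 'X))`_i = c ^+ i * p`_i.
Proof.
rewrite coef_comp_poly; under eq_bigr => j _ do rewrite exprZn coefZ coefXn.
have [ip|pi] := ltnP i (size p); last first.
  rewrite [p`_i]nth_default // mulr0 big1 // => j _.
  by rewrite gtn_eqF ?mulr0 // (leq_trans _ pi).
rewrite (bigD1 (Ordinal ip)) //= eqxx mulr1 big1 ?addr0 1?mulrC // => j ji.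
by rewrite [i == j]eq_sym (negbTE (ji : j != i :> nat)) !mulr0.
Qed.

Lemma sum_comp_poly_prim_root (L : fieldType) (m k : nat) (zeta : L)
    (p : {poly L}) : m.-primitive_root zeta -> (k < m)%N ->
  \sum_(t < m) zeta ^- (k * t) *: (p \Po (zeta ^+ t *: 'X)) =
  m%:R *: ('X^k * (poly_section m k p \Po 'X^m)).
Proof.
move=> hz km; have m0 := prim_order_gt0 hz.
apply/polyP=> i; rewrite coef_sum coefZ coefXnM coef_comp_poly_Xn //.
under eq_bigr => t _ do rewrite coefZ coef_comp_polyZX -exprM mulrA.
rewrite -mulr_suml (sum_prim_root_expr _ _ hz) coef_poly_section //.
have [ik|ki] := ltnP i k.
  (* As [i < k < m], the residues differ, in accordance with the factor ['X^k]. *)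
  by rewrite !modn_small ?(ltn_trans ik) // ltn_eqF // mulr0 mul0r.
rewrite eqn_mod_dvd //; case: ifP => [d|_]; last by rewrite mulr0 mul0r.
by rewrite mulnC divnK // subnK.
Qed.

(** Composition with a nonconstant [u] kills no nonzero polynomial, so a cross-multiplied equality
    can be pulled back along it. *)
Lemma ratfun_subst_inj (K L : fieldType) (iota : {rmorphism K -> L})
    (u : {poly L}) : (1 < size u)%N ->
  injective (fun f : ratfun K => ratfun_subst iota f u%:F).
Proof.
move=> u1 f g; have [p [q [q0 ->]]] := fracE f; have [r [s [s0 ->]]] := fracE g.
have nz t : t != 0 -> map_poly iota t \Po u != 0.
  by rewrite comp_poly_eq0 // map_poly_eq0.
move=> /eqP; rewrite !ratfun_subst_div // !eqr_div ?tofrac_eq0 ?nz // -!tofracM.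
rewrite !tofrac_eq -!comp_polyM -!rmorphM /= => h.
apply/eqP; rewrite eqr_div ?tofrac_eq0 // -!tofracM tofrac_eq -subr_eq0.
by rewrite -(map_poly_eq0 iota) -(comp_poly_eq0 _ u1) rmorphB comp_polyB subr_eq0.
Qed.

Theorem proposition1 (m k : nat) (K L : fieldType) (iota : {rmorphism K -> L})
    (zeta : L) (hm : (1 <= m)%N) (hk : (k < m)%N)
    (hmK : m%:R != 0 :> K) (hzeta : m.-primitive_root zeta)
    (phi : ratfun K) :
  exists! F : ratfun K,
    ratfun_subst iota F (ratfunX L ^+ m) =
    (m%:R * ratfunX L ^+ k)^-1 *
      \sum_(t < m) ratfunC (zeta ^- (k * t)) *
                   ratfun_subst iota phi (ratfunC (zeta ^+ t) * ratfunX L).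
Proof.
have sXm : (1 < size ('X^m : {poly L}))%N by rewrite size_polyXn.
have XmE : ratfunX L ^+ m = ('X^m)%:F by rewrite tofracXn.
suff [F hF] : exists F : ratfun K, ratfun_subst iota F (ratfunX L ^+ m) =
    (m%:R * ratfunX L ^+ k)^-1 *
      \sum_(t < m) ratfunC (zeta ^- (k * t)) *
                   ratfun_subst iota phi (ratfunC (zeta ^+ t) * ratfunX L).
  exists F; split=> // G hG; apply: (ratfun_subst_inj (iota := iota) sXm).
  by rewrite /= -XmE hF hG.
have [p [q [q0 ->]]] := fracE phi.
have [Q Q0 /dvdpP[s sq]] := dvdp_comp_poly_exists 'X^m q0.
have Qm0 : Q \Po 'X^m != 0 by rewrite comp_poly_eq0 // size_polyXn.
have s0 : s != 0 by apply: contraNneq Qm0 => s0; rewrite sq s0 mul0r.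
(* Expand the fraction by the cofactor [s], for which [Q \Po 'X^m = s * q]. *)
have -> : p%:F / q%:F = (s * p)%:F / (Q \Po 'X^m)%:F.
  by apply/eqP; rewrite eqr_div ?tofrac_eq0 // -!tofracM tofrac_eq sq mulrCA mulrA.
set P := s * p; pose D := (map_poly iota Q \Po 'X^m)%:F.
exists ((poly_section m k P)%:F / Q%:F).
rewrite XmE ratfun_subst_div // map_poly_section // -/D.
have z0 := prim_root_neq0 hzeta.
under eq_bigr => t _.
  rewrite /ratfunC /ratfunX -tofracM mul_polyC ratfun_subst_div //; last first.
    by rewrite size_scale ?expf_neq0 // size_polyX.
  (* The denominator is unchanged by [w -> zeta ^+ t * w], because [(zeta ^+ t) ^+ m = 1]; hence [D]
     does not depend on [t] and leaves the sum. *)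
  rewrite map_comp_poly map_polyXn -comp_polyA comp_Xn_poly exprZn exprAC.
  rewrite (prim_expr_order hzeta) expr1n scale1r -/D mulrA -tofracM.
  rewrite mul_polyC.
  over.
rewrite -mulr_suml -(raddf_sum (@FracField.tofrac _)) sum_comp_poly_prim_root //.
rewrite mulrA; congr (_ / _).
rewrite /= -mul_polyC mulrA tofracM mulrA.
have cE : m%:R * ratfunX L ^+ k = ((m%:R)%:P * 'X^k)%:F.
  by rewrite tofracM tofracXn polyC_natr tofracMn tofrac1.
rewrite cE mulVf ?mul1r // tofrac_eq0 mulf_neq0 ?(monic_neq0 (monicXn _ _)) //.
(* [m] stays nonzero in [L] since [iota] is injective. *)
by rewrite polyC_eq0 -(rmorph_nat iota) fmorph_eq0.
Qed.
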